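(* Let $\mathbf A,\mathbf B\in\mathbb R^{n\times n}$ be s.p.d. matrices. 1. (Invertible case.) If $\mathbf A\succ\mathbf 0$, then $\mathbf A\to\mathbf B$ and the OT matrix is unique: $$\mathbf S_{\mathbf A\to\mathbf B}:=(\mathbf G^* )^{-1}(\mathbf G^*\mathbf B\mathbf G)^{1/2}\mathbf G^{-1}\succeq\mathbf 0,$$ which is independent of the choice of Green's matrix $\mathbf G\in\mathcal G(\mathbf A)$. 2. (Singular case.) Suppose $\operatorname{rank}(\mathbf A)<n$, and use block decompositions with respect to $\mathcal H_1=\mathcal R(\mathbf A)$ and $\mathcal H_2=\mathcal N(\mathbf A)$. Then $\mathbf A\to\mathbf B$ if and only if $\operatorname{rank}(\mathbf A)\ge\operatorname{rank}(\mathbf B)$. In this case, $\mathbf T\in\mathbb R^{n\times n}$ is an OT matrix if and only if $$\mathbf T=\begin{pmatrix}(\mathbf G_{11}^* )^{-1}(\mathbf G_{11}^*\mathbf B_{11}\mathbf G_{11})^{1/2}\mathbf G_{11}^{-1}&\mathbf T_{12}\\ [\mathbf B_{21}\mathbf G_{11}(\mathbf G_{11}^*\mathbf B_{11}\mathbf G_{11})^{\dagger/2}+(\mathbf B/\mathbf A)^{1/2}\mathbf U_{12}^*]\mathbf G_{11}^{-1}&\mathbf T_{22}\end{pmatrix},$$ where $\mathbf T_{12}:\mathcal H_2\to\mathcal H_1$ and $\mathbf T_{22}:\mathcal H_2\to\mathcal H_2$ are arbitrary; $\mathbf G_{11}:\mathcal H_1\to\mathcal H_1$ is any Green's matrix for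 $\mathbf A_{11}$ (hence invertible); and $\mathbf U_{12}:\mathcal H_2\to\mathcal H_1$ is a partial isometry mapping from $\mathcal R(\mathbf B/\mathbf A)$ to a subspace $\mathcal V$ of $\mathcal N(\mathbf B_{11}^{1/2}\mathbf G_{11})$ of the same dimension, i.e. $\mathbf U_{12}^*\mathbf U_{12}=\boldsymbol\Pi_{\mathcal R(\mathbf B/\mathbf A)}$ and $\mathbf U_{12}\mathbf U_{12}^*=\boldsymbol\Pi_{\mathcal V}$. This construction (the resulting set of matrices) is independent of the choice of $\mathbf G_{11}\in\mathcal G(\mathbf A_{11})$. Additionally, $\mathbf T$ can always be made symmetric via $\mathbf T_{12}=\mathbf T_{21}^*$ and $\mathbf T_{22}=\mathbf T_{22}^*$.
   Context: s.p.d. (or $\succeq\mathbf 0$) means symmetric positive semidefinite; $\succ\mathbf 0$ positive definite. $^*$ is the transpose, $^\dagger$ the Moore–Penrose pseudoinverse, $\mathbf C^{\dagger/2}:=(\mathbf C^{1/2})^\dagger$, $\boldsymbol\Pi_{\mathcal V}$ the orthogonal projection onto $\mathcal V$, and $\mathcal R,\mathcal N$ are range and null space. A Green's matrix for $\mathbf A$, $\mathbf G\in\mathcal G(\mathbf A)$, is a square matrix (of the same size) with $\mathbf G\mathbf G^*=\mathbf A$. An OT matrix from $\mathbf A$ to $\mathbf B$ is $\mathbf T\in\mathbb R^{n\times n}$ with $\mathbf T\mathbf A\mathbf T^*=\mathbf B$ and $\operatorname{tr}(\mathbf A\mathbf T)=\operatorname{tr}[(\mathbf G^*\mathbf B\mathbf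 G)^{1/2}]$ for some (equivalently any) $\mathbf G\in\mathcal G(\mathbf A)$. Write $\mathbf A\to\mathbf B$ if one exists. Blocks: $\mathbf A_{11}=\mathbf A|_{\mathcal H_1}$ (other blocks of $\mathbf A$ vanish), $\mathbf B_{ij},\mathbf T_{ij}:\mathcal H_j\to\mathcal H_i$. Schur complement: $\mathbf B/\mathbf A:=\mathbf B_{22}-\mathbf B_{21}\mathbf B_{11}^\dagger\mathbf B_{12}:\mathcal H_2\to\mathcal H_2$. *)

(* Defs.v *)
From HB Require Import structures.
From mathcomp Require Import all_boot all_order all_algebra.
From mathcomp Require Import boolp classical_sets reals.

Set Implicit Arguments.
Unset Strict Implicit.
Unset Printing Implicit Defensive.

Import Order.TTheory GRing.Theory Num.Theory.
Local Open Scope classical_set_scope.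
Local Open Scope ring_scope.

Section Definitions.
Variable R : realType.

Definition psdmx n (A : 'M[R]_n) : Prop :=
  A^T = A /\ forall x : 'cV[R]_n, 0 <= (x^T *m A *m x) 0 0.

Definition pdmx n (A : 'M[R]_n) : Prop :=
  A^T = A /\ forall x : 'cV[R]_n, x != 0 -> 0 < (x^T *m A *m x) 0 0.

(* Matrices act on column vectors, so these are subspaces of columns (the
   spaces of mxalgebra are spanned by rows instead). *)
Definition mxrange m n (A : 'M[R]_(m, n)) : {vspace 'cV[R]_m} :=
  limg (linfun (mulmx A : 'cV[R]_n -> 'cV[R]_m)).

Definition mxnull m n (A : 'M[R]_(m, n)) : {vspace 'cV[R]_n} :=
  lker (linfun (mulmx A : 'cV[R]_n -> 'cV[R]_m)).

(* Moore-Penrose inverse (the pinvmx of mxalgebra is a different, generally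
   not Moore-Penrose, partial inverse).  The four Penrose equations have exactly
   one solution, so the default value 0 is never used. *)
Definition penrose m n (A : 'M[R]_(m, n)) (X : 'M[R]_(n, m)) : Prop :=
  [/\ A *m X *m A = A, X *m A *m X = X,
      (A *m X)^T = A *m X & (X *m A)^T = X *m A].

Definition mpinv m n (A : 'M[R]_(m, n)) : 'M[R]_(n, m) :=
  xget 0 [set X | penrose A X].

(* The positive semidefinite square root, unique when A is positive
   semidefinite; the default 0 is only used for other A. *)
Definition mxsqrt n (A : 'M[R]_n) : 'M[R]_n :=
  xget 0 [set S | psdmx S /\ S *m S = A].

Definition is_oproj n (V : {vspace 'cV[R]_n}) (P : 'M[R]_n) : Prop :=
  forall x : 'cV[R]_n, P *m x \in V /\
    forall v : 'cV[R]_n, v \in V -> v^T *m (x - P *m x) = 0.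

(* U is a partial isometry with initial space W and final space V. *)
Definition partial_isometry m n (U : 'M[R]_(m, n))
    (W : {vspace 'cV[R]_n}) (V : {vspace 'cV[R]_m}) : Prop :=
  is_oproj W (U^T *m U) /\ is_oproj V (U *m U^T).

Definition green n (A G : 'M[R]_n) : Prop := G *m G^T = A.

Definition is_OT n (A B T : 'M[R]_n) : Prop :=
  T *m A *m T^T = B /\
  exists2 G : 'M[R]_n, green A G &
    \tr (A *m T) = \tr (mxsqrt (G^T *m B *m G)).

Definition OT_exists n (A B : 'M[R]_n) : Prop := exists T, is_OT A B T.

(* Only meaningful for invertible G. *)
Definition OT_map n (G B : 'M[R]_n) : 'M[R]_n :=
  invmx G^T *m mxsqrt (G^T *m B *m G) *m invmx G.

(* The columns of E form an orthonormal basis of V.  Linear maps between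
   subspaces H_1 and H_2 are represented by their matrices with respect to
   such bases. *)
Definition onbasis n k (E : 'M[R]_(n, k)) (V : {vspace 'cV[R]_n}) : Prop :=
  E^T *m E = 1%:M /\ mxrange E = V.

(* The block V -> W of X, for orthonormal bases E of W and F of V. *)
Definition blk n p q (E : 'M[R]_(n, p)) (F : 'M[R]_(n, q)) (X : 'M[R]_n) :
    'M[R]_(p, q) := E^T *m X *m F.

(* The n x n matrix whose blocks are X11, X12, X21, X22. *)
Definition of_blocks n p q (E1 : 'M[R]_(n, p)) (E2 : 'M[R]_(n, q))
    (X11 : 'M[R]_p) (X12 : 'M[R]_(p, q)) (X21 : 'M[R]_(q, p)) (X22 : 'M[R]_q) :
    'M[R]_n :=
  row_mx E1 E2 *m block_mx X11 X12 X21 X22 *m (row_mx E1 E2)^T.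

(* B / A, where E1 and E2 are bases of the range and null space of A. *)
Definition schur n p q (E1 : 'M[R]_(n, p)) (E2 : 'M[R]_(n, q)) (B : 'M[R]_n) :
    'M[R]_q :=
  blk E2 E2 B - blk E2 E1 B *m mpinv (blk E1 E1 B) *m blk E1 E2 B.

Section OTBlocks.
Variables (n p q : nat) (E1 : 'M[R]_(n, p)) (E2 : 'M[R]_(n, q)).
Variables (B : 'M[R]_n) (G11 : 'M[R]_p).

Definition OT_partial_isometry (U12 : 'M[R]_(p, q)) : Prop :=
  exists V : {vspace 'cV[R]_p},
    [/\ (V <= mxnull (mxsqrt (blk E1 E1 B) *m G11))%VS,
        \dim V = \dim (mxrange (schur E1 E2 B)) &
        partial_isometry U12 (mxrange (schur E1 E2 B)) V].

Definition OT_block21 (U12 : 'M[R]_(p, q)) : 'M[R]_(q, p) :=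
  (blk E2 E1 B *m G11 *m mpinv (mxsqrt (G11^T *m blk E1 E1 B *m G11))
   + mxsqrt (schur E1 E2 B) *m U12^T) *m invmx G11.

Definition OT_matrix (U12 T12 : 'M[R]_(p, q)) (T22 : 'M[R]_q) : 'M[R]_n :=
  of_blocks E1 E2 (OT_map G11 (blk E1 E1 B)) T12 (OT_block21 U12) T22.

Definition OT_family : set 'M[R]_n :=
  [set T | exists U12 T12 T22,
     OT_partial_isometry U12 /\ T = OT_matrix U12 T12 T22].

End OTBlocks.
End Definitions.

(* Main.v *)
Require Import Defs.
From HB Require Import structures.
From mathcomp Require Import all_boot all_order all_algebra complex.
From mathcomp Require Import boolp classical_sets reals.

Set Implicit Arguments.
Unset Strict Implicit.
Unset Printing Implicit Defensive.

Import Order.TTheory GRing.Theory Num.Theory.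
Local Open Scope classical_set_scope.
Local Open Scope ring_scope.

(* Let H be any rectangular factor of A, A = H H^T.  If T A T^T = B, then
   M := H^T T H satisfies M M^T = H^T B H, and the trace condition says that
   tr M = tr C with C := (H^T B H)^(1/2); the trace of
   (M - C)^T C^+ (M - C) then vanishes, which forces M = C.  Hence T is an OT
   matrix iff T A T^T = B and H^T T H = C.  For A invertible and H = G this
   determines T.  For A singular take H = E1 G11, where the columns of E1 are an
   orthonormal basis of R(A): T11 is determined as before, and
   K := T21 G11 must solve K C = B21 G11, K K^T = B22.  The particular solution
   K0 := B21 G11 C^+ of the first equation satisfies
   K0 K0^T = B21 B11^+ B12, so L := K - K0 ranges over the solutions of L C = 0,
   L L^T = B/A; these are the L = (B/A)^(1/2) U^T with U a partial isometry from
   R(B/A) into N(C), and they exist iff rank B <= rank A because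
   rank B11 + rank (B/A) <= rank B. *)

(** * Gram matrices and positive semidefiniteness *)

Section Gram.
Variable R : realType.

Lemma mxtrace_gram m n (X : 'M[R]_(m, n)) :
  \tr (X^T *m X) = \sum_j \sum_i X i j ^+ 2.
Proof.
by apply: eq_bigr => j _; rewrite mxE; apply: eq_bigr => i _; rewrite mxE expr2.
Qed.

Lemma mxtrace_gram_ge0 m n (X : 'M[R]_(m, n)) : 0 <= \tr (X^T *m X).
Proof.
by rewrite mxtrace_gram; do 2![apply: sumr_ge0 => ? _]; exact: sqr_ge0.
Qed.

Lemma mxtrace_gram_eq0 m n (X : 'M[R]_(m, n)) : \tr (X^T *m X) = 0 -> X = 0.
Proof.
rewrite mxtrace_gram => X0; apply/matrixP=> i j; rewrite mxE.
have ge0 k : 0 <= \sum_l X l k ^+ 2 by apply: sumr_ge0 => l _; exact: sqr_ge0.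
have /eqP : \sum_l X l j ^+ 2 = 0 by exact: (psumr_eq0P _ X0).
rewrite psumr_eq0 => [/allP/(_ i)|l _]; last exact: sqr_ge0.
by rewrite mem_index_enum sqrf_eq0 => /(_ isT)/eqP.
Qed.

Lemma gram_eq0 m n (X : 'M[R]_(m, n)) : X^T *m X = 0 -> X = 0.
Proof. by move=> X0; apply: mxtrace_gram_eq0; rewrite X0 mxtrace0. Qed.

Lemma mul_gram_eq0 m n k (X : 'M[R]_(m, n)) (Y : 'M[R]_(n, k)) :
  X^T *m X *m Y = 0 -> X *m Y = 0.
Proof.
by move=> XY0; apply: gram_eq0; rewrite trmx_mul -mulmxA (mulmxA X^T) XY0 mulmx0.
Qed.

Lemma psdmx_gram m n (X : 'M[R]_(m, n)) : psdmx (X^T *m X).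
Proof.
split=> [|x]; first by rewrite trmx_mul trmxK.
by have := mxtrace_gram_ge0 (X *m x); rewrite trace_mx11 trmx_mul !mulmxA.
Qed.

Lemma psdmx_congr m n (A : 'M[R]_m) (X : 'M[R]_(m, n)) :
  psdmx A -> psdmx (X^T *m A *m X).
Proof.
move=> [AT A0]; split=> [|x]; first by rewrite !trmx_mul trmxK AT mulmxA.
by have := A0 (X *m x); rewrite trmx_mul !mulmxA.
Qed.

End Gram.

(** * Polynomial functional calculus for positive semidefinite matrices *)

Section FunctionalCalculus.
Variable R : realType.

Lemma psdmx_eigenvalue_ge0 n (A : 'M[R]_n) a :
  psdmx A -> eigenvalue A a -> 0 <= a.
Proof.
move=> [_ A0] /eigenvalueP[v vA v0].
have := A0 v^T; rewrite trmxK vA -scalemxAl mxE.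
have := mxtrace_gram_ge0 v^T; rewrite trmxK trace_mx11 le_eqVlt => /orP[/eqP v00|].
  by case/eqP: v0; apply: trmx_inj; rewrite trmx0; apply: mxtrace_gram_eq0;
    rewrite trmxK trace_mx11 -v00.
by move=> vv; rewrite pmulr_lge0.
Qed.

(* s lists the eigenvalues of the complexification of A, which is hermitian. *)
Lemma psdmx_annihilator n (A : 'M[R]_n.+1) : psdmx A ->
  exists2 s : seq R, all (>= 0) s &
    forall p : {poly R}, all (root p) s -> horner_mx A p = 0.
Proof.
move=> Apsd; pose f : {rmorphism R -> R[i]} := real_complex R.
pose AC := map_mx f A.
have ACherm : AC \is hermsymmx.
  apply: realsym_hermsym.
    by apply/is_hermitianmxP; rewrite expr0 scale1r map_mx_id// map_trmx Apsd.1.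
  by apply/mxOverP=> i j; rewrite !mxE; apply/complex_realP; exists (A i j).
have /orthomx_spectralP ACE := hermitian_normalmx ACherm.
set P := spectralmx AC in ACE; set d := spectral_diag AC in ACE.
have Pu : P \is a GRing.unit by exact: spectral_unit.
have dreal j : f (complex.Re (d 0 j)) = d 0 j.
  by apply: RRe_real; apply: (mxOverP (hermitian_spectral_diag_real ACherm)).
exists [seq complex.Re (d 0 j) | j <- enum 'I_n.+1].
  apply/allP=> _ /mapP[j _ ->]; apply: (psdmx_eigenvalue_ge0 Apsd).
  (* The eigenvector at hand is complex, whereas positivity of A concerns real vectors; the
     eigenvalue passes to A through the characteristic polynomial. *)
  rewrite eigenvalue_root_char -(fmorph_root f) map_char_poly -eigenvalue_root_char.
  apply/eigenvalueP; exists (delta_mx 0 j *m P).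
    rewrite -/AC ACE !mulmxA mulmxK// -[f _]/(_%:C)%C.
    rewrite scalemxAl; congr (_ *m _).
    apply/rowP=> k; rewrite mul_mx_diag !mxE eqxx /= -[(_%:C)%C]/(f _) dreal mulrC.
    by case: eqP => [->|]; rewrite ?mulr0.
  apply/negP => /eqP/(congr1 (mulmx^~ (invmx P))); rewrite mulmxK// mul0mx.
  by move/matrixP/(_ 0 j)/eqP; rewrite !mxE !eqxx oner_eq0.
move=> p /allP ps; apply: (map_mx_inj (f := f)).
rewrite map_horner_mx -/AC map_mx0 ACE horner_mx_uconjC// horner_mx_diag.
rewrite (_ : map_mx _ _ = 0) ?linear0 ?mulmx0 ?mul0mx//.
apply/rowP=> j; rewrite !mxE -dreal horner_map.
by rewrite (eqP (ps _ _)) ?rmorph0//; apply/mapP; exists j; rewrite ?mem_enum.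
Qed.

(** Combined with [psdmx_annihilator], this realizes any function of A as a polynomial in A, hence
    as a symmetric matrix commuting with A. The inductive step adds a multiple of a polynomial that
    vanishes on s. *)
Lemma interpolation (F : fieldType) (s : seq F) (f : F -> F) :
  exists p : {poly F}, {in s, forall x, p.[x] = f x}.
Proof.
elim: s => [|a s [p ps]]; first by exists 0.
have [as_|nas] := boolP (a \in s).
  by exists p => x; rewrite inE => /orP[/eqP->|]; apply: ps.
pose q := \prod_(x <- s) ('X - x%:P).
have qa : q.[a] != 0 by rewrite -[_ == 0]/(root q a) root_prod_XsubC.
exists (p + ((f a - p.[a]) / q.[a]) *: q) => x; rewrite inE !hornerE.
move=> /predU1P[->|xs]; first by rewrite divfK// addrC subrK.
have /eqP-> : root q x by rewrite root_prod_XsubC.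
by rewrite mulr0 addr0 ps.
Qed.

Lemma horner_mx_sym n (A : 'M[R]_n.+1) p : A^T = A ->
  (horner_mx A p)^T = horner_mx A p.
Proof.
move=> AT; elim/poly_ind: p => [|p c IH]; first by rewrite rmorph0 trmx0.
rewrite !(rmorphD, rmorphM)/= horner_mx_X horner_mx_C linearD/= tr_scalar_mx.
by rewrite trmx_mul IH AT [X in X + _](@comm_mx_horner _ _ A)//; apply: comm_mx_refl.
Qed.

Lemma psdmx_sqrt_ex n (A : 'M[R]_n) : psdmx A -> exists S, psdmx S /\ S *m S = A.
Proof.
case: n A => [|n] A Apsd.
  by exists 0; split; [have := psdmx_gram (0 : 'M[R]_0); rewrite mulmx0|
    rewrite flatmx0 [A]flatmx0].
have [s s0 sA] := psdmx_annihilator Apsd.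
(* Fourth roots are interpolated, so that the square root p(A)^2 is itself a Gram matrix and thus
   positive semidefinite. *)
have [p ps] := interpolation s (fun x => Num.sqrt (Num.sqrt x)).
have pT := horner_mx_sym p Apsd.1.
exists (horner_mx A p *m horner_mx A p); split.
  by rewrite -{1}pT; apply: psdmx_gram.
have : horner_mx A (p ^+ 4 - 'X) = 0.
  apply/sA/allP=> x xs; rewrite rootE !hornerE ps// -[4%N]/((2 * 2)%N) exprM.
  by rewrite !sqr_sqrtr ?subrr ?sqrtr_ge0 ?(allP s0).
rewrite rmorphB/= horner_mx_X => /subr0_eq pA.
transitivity (horner_mx A (p ^+ 4)) => //.
have -> : p ^+ 4 = p * p * (p * p) by rewrite !exprS expr0 mulr1 !mulrA.
by rewrite !rmorphM.
Qed.

Lemma psdmx_penrose_ex n (A : 'M[R]_n) : psdmx A -> exists X, penrose A X.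
Proof.
case: n A => [|n] A Apsd.
  by exists 0; split; apply/matrixP => -[].
have [s _ sA] := psdmx_annihilator Apsd.
(* Since 0^-1 = 0, the identity x x^-1 x = x holds at the eigenvalue 0 too. *)
have [p ps] := interpolation s (fun x => x^-1).
have pT := horner_mx_sym p Apsd.1.
have pAC : A *m horner_mx A p = horner_mx A p *m A.
  exact/comm_mx_horner/comm_mx_refl.
have key (q r : {poly R}) : {in s, forall x, q.[x] = r.[x]} ->
    horner_mx A q = horner_mx A r.
  move=> qr; apply: subr0_eq; rewrite -rmorphB/= sA//.
  by apply/allP=> x xs; rewrite rootE !hornerE qr// subrr.
have inv3 (x : R) : x * x^-1 * x = x.
  by have [->|x0] := eqVneq x 0; rewrite ?mulr0// divff// mul1r.
exists (horner_mx A p); split.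
- have := key ('X * p * 'X) 'X; rewrite !rmorphM/= horner_mx_X; apply.
  by move=> x xs; rewrite !hornerE ps.
- have := key (p * 'X * p) p; rewrite !rmorphM/= horner_mx_X; apply.
  by move=> x xs; rewrite !hornerE ps//; have := inv3 x^-1; rewrite invrK.
- by rewrite trmx_mul pT Apsd.1.
- by rewrite trmx_mul pT Apsd.1.
Qed.

End FunctionalCalculus.

(** * Existence and uniqueness of the square root *)

Section SquareRoot.
Variable R : realType.

Lemma mxsqrtP n (A : 'M[R]_n) : psdmx A ->
  psdmx (mxsqrt A) /\ mxsqrt A *m mxsqrt A = A.
Proof. by move=> /psdmx_sqrt_ex; apply: (@xgetPex _ 0 [set S | psdmx S /\ S *m S = A]). Qed.

Lemma psdmx_factor n (A : 'M[R]_n) : psdmx A ->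
  exists S : 'M[R]_n, A = S^T *m S.
Proof.
by move=> /mxsqrtP[[ST _] SS]; exists (mxsqrt A); rewrite ST SS.
Qed.

Lemma psdmx_mxtrace_ge0 m n (A : 'M[R]_m) (X : 'M[R]_(m, n)) :
  psdmx A -> 0 <= \tr (X^T *m A *m X).
Proof.
move=> /psdmx_factor[S ->]; have := mxtrace_gram_ge0 (S *m X).
by rewrite trmx_mul !mulmxA.
Qed.

Lemma psdmx_mxtrace_eq0 m n (A : 'M[R]_m) (X : 'M[R]_(m, n)) :
  psdmx A -> \tr (X^T *m A *m X) = 0 -> A *m X = 0.
Proof.
move=> /psdmx_factor[S ->] X0; rewrite -mulmxA (_ : S *m X = 0) ?mulmx0//.
by apply: mxtrace_gram_eq0; rewrite trmx_mul !mulmxA -(mulmxA X^T).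
Qed.

(* With D := S1 - S2, D S1 + S2 D = S1^2 - S2^2 = 0, so that
   tr (D S1 D) + tr (D S2 D) = 0. *)
Lemma psdmx_sqrt_inj n (S1 S2 : 'M[R]_n) : psdmx S1 -> psdmx S2 ->
  S1 *m S1 = S2 *m S2 -> S1 = S2.
Proof.
move=> p1 p2 SS; set D := S1 - S2.
have DT : D^T = D by rewrite linearB/= p1.1 p2.1.
have DS : D *m S1 + S2 *m D = 0.
  by rewrite mulmxBl mulmxBr SS addrA addrNK subrr.
have tr0 : \tr (D^T *m S1 *m D) + \tr (D^T *m S2 *m D) = 0.
  rewrite DT mxtrace_mulC mulmxA -mxtraceD -[in X in _ + X]mulmxA.
  by rewrite -(mulmxA D D) -mulmxDr DS mulmx0 mxtrace0.
have [/eqP t1 /eqP t2] : \tr (D^T *m S1 *m D) == 0 /\ \tr (D^T *m S2 *m D) == 0.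
  by apply/andP; rewrite -paddr_eq0 ?tr0// psdmx_mxtrace_ge0.
apply: subr0_eq; apply: gram_eq0; rewrite -/D DT mulmxBl.
by rewrite (psdmx_mxtrace_eq0 p1 t1) (psdmx_mxtrace_eq0 p2 t2) subrr.
Qed.

Lemma mxsqrt_unique n (A S : 'M[R]_n) : psdmx S -> S *m S = A -> mxsqrt A = S.
Proof.
move=> Sp SA; have Ap : psdmx A by rewrite -SA -{1}Sp.1; apply: psdmx_gram.
by have [p2 E] := mxsqrtP Ap; apply: psdmx_sqrt_inj; rewrite ?E.
Qed.

End SquareRoot.

(** * The Moore-Penrose inverse and the equality case of the trace bound *)

Section PseudoInverse.
Variable R : realType.

(** Both X and Y equal X A Y: transposing A Y A X = A X gives A X A Y = A X, and transposing Y A X A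
    = Y A gives X A Y A = Y A. *)
Lemma penrose_inj m n (A : 'M[R]_(m, n)) X Y :
  penrose A X -> penrose A Y -> X = Y.
Proof.
move=> [AXA XAX AX XA] [AYA YAY AY YA].
have -> : X = X *m A *m Y.
  have e : X *m ((A *m X)^T *m (A *m Y)^T) = X.
    by rewrite -trmx_mul mulmxA AYA AX mulmxA.
  by rewrite -[LHS]e AX AY !mulmxA XAX.
have e : ((X *m A)^T *m (Y *m A)^T) *m Y = Y.
  by rewrite -trmx_mul -(mulmxA Y) (mulmxA A) AXA YA.
by rewrite -[RHS]e XA YA -!mulmxA (mulmxA Y) YAY.
Qed.

Variables (n : nat) (S : 'M[R]_n).
Hypothesis Spsd : psdmx S.

Lemma mpinvP : penrose S (mpinv S).
Proof. exact: (@xgetPex _ 0 [set X | penrose S X]) (psdmx_penrose_ex Spsd). Qed.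

Lemma mulmxVKpinv : S *m mpinv S *m S = S.
Proof. by case: mpinvP. Qed.

(** For symmetric S, transposition exchanges the two symmetry equations of Penrose and preserves the
    other two, so uniqueness applies. *)
Lemma tr_mpinv : (mpinv S)^T = mpinv S.
Proof.
apply: (penrose_inj _ mpinvP); have := mpinvP; have ST := Spsd.1.
move: (mpinv S) => P [E1 E2 E3 E4]; split.
- by rewrite -{1 2}ST -!trmx_mul mulmxA E1.
- by rewrite -{1}ST -!trmx_mul mulmxA E2.
- by rewrite -ST -!trmx_mul trmxK E4.
- by rewrite -ST -!trmx_mul trmxK E3.
Qed.

Lemma mpinvC : mpinv S *m S = S *m mpinv S.
Proof. by have [_ _ E3 _] := mpinvP; rewrite -E3 trmx_mul tr_mpinv Spsd.1. Qed.

Lemma mpinvE : mpinv S = S *m mpinv S *m mpinv S.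
Proof. by rewrite -mpinvC; case: mpinvP. Qed.

Lemma psdmx_mpinv : psdmx (mpinv S).
Proof.
have [_ E _ _] := mpinvP.
by rewrite -E -{1}tr_mpinv; apply: psdmx_congr.
Qed.

(* R(M) = R(M M^T) is contained in R(S). *)
Lemma mpinv_gramK m (M : 'M[R]_(n, m)) (Y : 'M[R]_n) :
  M *m M^T = S *m Y -> S *m mpinv S *m M = M.
Proof.
move=> MM; apply/esym/subr0_eq; rewrite -{1}[M]mul1mx -mulmxBl.
apply: trmx_inj; rewrite trmx0; apply: gram_eq0; rewrite trmxK trmx_mul.
rewrite mulmxA -(mulmxA _ M) MM mulmxA mulmxBl mul1mx mulmxVKpinv subrr.
by rewrite !mul0mx.
Qed.

(* tr ((M - S)^T S^+ (M - S)) = 2 (tr S - tr M). *)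
Lemma mxtrace_max_eq (M : 'M[R]_n) :
  M *m M^T = S *m S -> \tr M = \tr S -> M = S.
Proof.
move=> MM trM; have SPM := mpinv_gramK MM.
have [SPS _ _ _] := mpinvP.
have tSPM : M^T *m mpinv S *m S = M^T.
  by rewrite -{2}SPM !trmx_mul tr_mpinv Spsd.1 mulmxA.
have D0 : mpinv S *m (M - S) = 0.
  apply: (psdmx_mxtrace_eq0 psdmx_mpinv).
  have -> : (M - S)^T = M^T - S by rewrite linearB/= Spsd.1.
  rewrite mulmxBl mulmxBl !mulmxBr !raddfB/= SPM SPS tSPM mxtrace_tr.
  rewrite mxtrace_mulC mulmxA MM -mulmxA -mpinvC mulmxA SPS trM.
  by rewrite subrr add0r opprK addNr.
(* S S^+ fixes both M and S, so S^+ (M - S) = 0 suffices. *)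
apply: subr0_eq; have := congr1 (mulmx S) D0.
by rewrite mulmx0 mulmxA mulmxBr SPM SPS.
Qed.

End PseudoInverse.

(** * Characterization of OT matrices and the invertible case *)

Section OptimalTransport.
Variable R : realType.

(** With S the square root of X^T X, the square root of X X^T is X S^+ X^T, and cyclicity turns its
    trace into tr (S^+ S^2) = tr S. *)
Lemma mxtrace_mxsqrt_gram m n (X : 'M[R]_(m, n)) :
  \tr (mxsqrt (X *m X^T)) = \tr (mxsqrt (X^T *m X)).
Proof.
have [Sp SS] := mxsqrtP (psdmx_gram X); set S := mxsqrt _ in Sp SS *.
have SPX : S *m mpinv S *m X^T = X^T.
  by apply: (mpinv_gramK Sp (Y := S)); rewrite trmxK SS.
rewrite (@mxsqrt_unique _ _ _ (X *m mpinv S *m X^T)).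
- by rewrite -mulmxA mxtrace_mulC -mulmxA -SS mulmxA (mpinvC Sp)
    (mulmxVKpinv Sp).
- by have := psdmx_congr X^T (psdmx_mpinv Sp); rewrite trmxK.
- rewrite !mulmxA -(mulmxA (X *m _)) -SS -!mulmxA (mulmxA S _ X^T).
  by rewrite SPX (mulmxA _ S) (mpinvC Sp) SPX.
Qed.

(** The trace of the square root of G^T B G is the same for every factor G of A: with b the square
    root of B, it equals that of b A b. The factor H may be rectangular so as to cover E1 G11. *)
Lemma is_OTE n p (A B T : 'M[R]_n) (H : 'M[R]_(n, p)) :
  psdmx A -> psdmx B -> H *m H^T = A ->
  is_OT A B T <-> T *m A *m T^T = B /\ H^T *m T *m H = mxsqrt (H^T *m B *m H).
Proof.
move=> Ap Bp HA; have [bp bb] := mxsqrtP Bp; set b := mxsqrt B in bp bb.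
have trE q (G : 'M[R]_(n, q)) : G *m G^T = A ->
    \tr (mxsqrt (G^T *m B *m G)) = \tr (mxsqrt (b *m A *m b)).
  move=> GA; have := mxtrace_mxsqrt_gram (b *m G).
  by rewrite trmx_mul bp.1 !mulmxA -(mulmxA b G) GA -(mulmxA _ b b) bb => <-.
have trAT : \tr (A *m T) = \tr (H^T *m T *m H).
  by rewrite -HA -mulmxA mxtrace_mulC.
split=> [[TB [G GA trT]]|[TB HT]]; split=> //; last first.
  have [Sp SS] := mxsqrtP Ap.
  exists (mxsqrt A); first by rewrite /green Sp.1.
  by rewrite trAT HT (trE _ _ HA) trE// Sp.1.
have [Cp CC] := mxsqrtP (psdmx_congr H Bp).
apply: (mxtrace_max_eq Cp); last by rewrite -trAT trT (trE _ _ HA) trE.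
by rewrite CC -TB -HA !trmx_mul !trmxK !mulmxA.
Qed.

Lemma OT_mapP n (G B : 'M[R]_n) : psdmx B -> G \in unitmx ->
  psdmx (OT_map G B) /\ G^T *m OT_map G B *m G = mxsqrt (G^T *m B *m G).
Proof.
move=> Bp Gu; have [Cp _] := mxsqrtP (psdmx_congr G Bp); split.
  by rewrite /OT_map -trmx_inv; apply: psdmx_congr.
by rewrite /OT_map !mulmxA mulmxV ?unitmx_tr// mul1mx mulmxKV.
Qed.

Lemma OT_map_unique n (G B T : 'M[R]_n) : G \in unitmx ->
  G^T *m T *m G = mxsqrt (G^T *m B *m G) -> T = OT_map G B.
Proof. by move=> Gu TC; rewrite /OT_map -TC !mulmxA mulVmx ?unitmx_tr// mul1mx mulmxK. Qed.

Lemma pdmx_unit n (A : 'M[R]_n) : pdmx A -> A \in unitmx.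
Proof.
move=> [_ A0]; rewrite -row_free_unit -kermx_eq0; apply/eqP/row_matrixP=> i.
rewrite row0; apply/eqP; apply: contraT => v0.
have : row i (kermx A) *m A = 0 by rewrite -row_mul mulmx_ker row0.
set v := row _ _ in v0 * => vA; have := A0 v^T.
by rewrite trmxK vA mul0mx mxE ltxx -trmx0 (inj_eq trmx_inj) v0 => /(_ isT).
Qed.

Lemma OT_map_transport n (G B : 'M[R]_n) : psdmx B -> G \in unitmx ->
  OT_map G B *m (G *m G^T) *m (OT_map G B)^T = B.
Proof.
move=> Bp Gu; have [Cp CC] := mxsqrtP (psdmx_congr G Bp).
have [[-> _] _] := OT_mapP Bp Gu.
rewrite /OT_map !mulmxA mulmxKV// -(mulmxA _ G^T) mulmxV ?unitmx_tr// mulmx1.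
by rewrite -(mulmxA (invmx G^T)) CC !mulmxA mulVmx ?unitmx_tr// mul1mx mulmxK.
Qed.

Lemma is_OT_pd n (A B G T : 'M[R]_n) : psdmx A -> psdmx B ->
  G \in unitmx -> green A G -> is_OT A B T <-> T = OT_map G B.
Proof.
move=> Ap Bp Gu GA; rewrite (is_OTE T Ap Bp GA).
split=> [[_]|->]; first exact: OT_map_unique.
by rewrite -GA OT_map_transport// (OT_mapP Bp Gu).2.
Qed.

End OptimalTransport.

(** * Column ranges, orthogonal projections and orthonormal bases *)

Section Ranges.
Variable R : realType.

Lemma mulmx_col m n k (A : 'M[R]_(m, n)) (B : 'M[R]_(n, k)) j :
  A *m col j B = col j (A *m B).
Proof. by rewrite !colE mulmxA. Qed.

Lemma mem_mxrangeP m n (A : 'M[R]_(m, n)) v :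
  reflect (exists x, v = A *m x) (v \in mxrange A).
Proof.
by apply: (iffP memv_imgP) => [[x _ ->]|[x ->]]; exists x; rewrite ?memvf ?lfunE.
Qed.

Lemma mem_mxnull m n (A : 'M[R]_(m, n)) v : (v \in mxnull A) = (A *m v == 0).
Proof. by rewrite memv_ker lfunE. Qed.

Lemma mxrange_subP m n k (A : 'M[R]_(m, n)) (B : 'M[R]_(m, k)) :
  reflect (exists Z, A = B *m Z) (mxrange A <= mxrange B)%VS.
Proof.
apply: (iffP idP) => [AB|[Z ->]]; last first.
  apply/subvP=> _ /mem_mxrangeP[x ->]; apply/mem_mxrangeP.
  by exists (Z *m x); rewrite mulmxA.
have cols j : exists z, col j A = B *m z.
  apply/mem_mxrangeP/(subvP AB)/mem_mxrangeP.
  by exists (delta_mx j 0); rewrite colE.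
have [z zP] := choice cols; exists (\matrix_(i, j) z j i 0).
apply/matrixP=> i j; have /matrixP/(_ i 0) := zP j; rewrite !mxE => ->.
by apply: eq_bigr => k' _; rewrite mxE.
Qed.

Lemma mxrange_sub_mxnull m n k (A : 'M[R]_(m, n)) (B : 'M[R]_(n, k)) :
  (mxrange B <= mxnull A)%VS = (A *m B == 0).
Proof.
apply/idP/eqP => [BA|AB0]; last first.
  by apply/subvP=> _ /mem_mxrangeP[x ->]; rewrite mem_mxnull mulmxA AB0 mul0mx.
apply/matrixP=> i j; have : col j B \in mxnull A.
  by apply/(subvP BA)/mem_mxrangeP; exists (delta_mx j 0); rewrite colE.
by rewrite mem_mxnull mulmx_col => /eqP/matrixP/(_ i 0); rewrite mxE => ->; rewrite !mxE.
Qed.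

Lemma dim_mxrange_mul_le m n k (A : 'M[R]_(m, n)) (B : 'M[R]_(n, k)) :
  (\dim (mxrange (A *m B)) <= \dim (mxrange B))%N.
Proof.
have -> : mxrange (A *m B) = (linfun (mulmx A) @: mxrange B)%VS.
  rewrite -limg_comp; apply/eqP; rewrite eqEsubv.
  by apply/andP; split; apply/subvP=> _ /memv_imgP[x _ ->]; apply/memv_imgP;
    exists x; rewrite ?memvf//= !(comp_lfunE, lfunE)/= mulmxA.
by rewrite -[leqRHS](limg_ker_dim (linfun (mulmx A))) leq_addl.
Qed.

(** Each of U and U^T U is a left multiple of the other, and left multiplication cannot raise the
    dimension of the range. *)
Lemma dim_mxrange_gram m n (U : 'M[R]_(m, n)) : U *m U^T *m U = U ->
  \dim (mxrange U) = \dim (mxrange (U^T *m U)).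
Proof.
by move=> UUU; apply/eqP; rewrite eqn_leq -{1}UUU -mulmxA !dim_mxrange_mul_le.
Qed.

Lemma is_oproj_fix n (V : {vspace 'cV[R]_n}) P k (X : 'M[R]_(n, k)) :
  is_oproj V P -> (mxrange X <= V)%VS -> P *m X = X.
Proof.
move=> VP XV; have fixP v : v \in V -> P *m v = v.
  move=> vV; have [PvV Pv] := VP v; apply/esym/subr0_eq/gram_eq0.
  by apply: Pv; rewrite rpredB.
apply/matrixP=> i j; have /fixP/matrixP/(_ i 0) : col j X \in V.
  by apply/(subvP XV)/mem_mxrangeP; exists (delta_mx j 0); rewrite colE.
by rewrite mulmx_col !mxE.
Qed.

Lemma is_oproj_sub n (V : {vspace 'cV[R]_n}) P :
  is_oproj V P -> (mxrange P <= V)%VS.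
Proof. by move=> VP; apply/subvP=> _ /mem_mxrangeP[x ->]; case: (VP x). Qed.

(** Symmetry of S Z turns S Z S = S into S^T S Z = S^T, which makes x - S Z x orthogonal to R(S). *)
Lemma is_oproj_mxrange n k (S : 'M[R]_(n, k)) Z :
  (S *m Z)^T = S *m Z -> S *m Z *m S = S -> is_oproj (mxrange S) (S *m Z).
Proof.
move=> PT PS x; split; first by apply/mem_mxrangeP; exists (Z *m x); rewrite mulmxA.
have e : S^T *m (S *m Z) = S^T by rewrite -PT -trmx_mul PS.
move=> _ /mem_mxrangeP[y ->]; rewrite trmx_mul mulmxBr -!mulmxA (mulmxA S).
by rewrite (mulmxA S^T) e subrr.
Qed.

Lemma mxsqrt_sub_mxrange n (A : 'M[R]_n) : psdmx A ->
  exists Z, mxsqrt A = A *m Z.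
Proof.
move=> /mxsqrtP[Sp SS]; exists (mpinv (mxsqrt A)).
by rewrite -{2}SS -mulmxA -(mpinvC Sp) mulmxA (mulmxVKpinv Sp).
Qed.

Lemma gram_unit m n (X : 'M[R]_(m, n)) : row_free X^T -> X^T *m X \in unitmx.
Proof.
move=> Xf; rewrite -row_free_unit -kermx_eq0; set K := kermx _.
have : K *m (X^T *m X) = 0 by apply: mulmx_ker.
move: K => K /(congr1 trmx); rewrite trmx0 !trmx_mul trmxK => /mul_gram_eq0.
move/(congr1 trmx); rewrite trmx0 trmx_mul trmxK => /eqP.
by rewrite mulmx_free_eq0.
Qed.

Lemma onbasis_ex m n (M : 'M[R]_(m, n)) :
  exists F : 'M[R]_(m, \rank M), onbasis F (mxrange M).
Proof.
set c := col_base M; have cfree : row_free c^T.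
  by rewrite /row_free mxrank_tr; have := col_base_full M; rewrite /row_full.
have cu := gram_unit cfree.
have [Np NN] := mxsqrtP (psdmx_gram c); set N := mxsqrt _ in Np NN.
have Nu : N \in unitmx by move: cu; rewrite -NN unitmx_mul => /andP[].
(* Symmetric orthonormalization of the column basis c, with N the square root of c^T c. *)
exists (c *m invmx N); split.
  rewrite trmx_mul trmx_inv Np.1 mulmxA -(mulmxA _ c^T) -NN mulmxA.
  by rewrite mulVmx// mul1mx mulmxV.
apply/eqP; rewrite eqEsubv; apply/andP; split; apply/mxrange_subP.
  exists (pinvmx (row_base M) *m invmx N); rewrite mulmxA.
  suff -> : c = M *m pinvmx (row_base M) by [].
  have -> : M *m pinvmx (row_base M) = c *m row_base M *m pinvmx (row_base M).
    by rewrite mulmx_base.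
  by rewrite -mulmxA mulmxVp ?row_base_free// mulmx1.
by exists (N *m row_base M); rewrite mulmxA mulmxKV// mulmx_base.
Qed.

(** Writing the null space as the range of the projection 1 - A A^+ makes [onbasis_ex] applicable to
    it. *)
Lemma mxnull_psd n (A : 'M[R]_n) : psdmx A ->
  mxnull A = mxrange (1%:M - A *m mpinv A).
Proof.
move=> Ap; apply/eqP; rewrite eqEsubv mxrange_sub_mxnull mulmxBr mulmx1 -(mpinvC Ap).
rewrite mulmxA (mulmxVKpinv Ap) subrr eqxx andbT.
apply/subvP=> x; rewrite mem_mxnull => /eqP Ax; apply/mem_mxrangeP; exists x.
by rewrite mulmxBl mul1mx -mulmxA Ax mulmx0 subr0.
Qed.

Lemma onbasis_range_ex n (A : 'M[R]_n) :
  exists (p : nat) (E : 'M[R]_(n, p)), onbasis E (mxrange A).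
Proof. by have [E ?] := onbasis_ex A; exists (\rank A), E. Qed.

Lemma onbasis_null_ex n (A : 'M[R]_n) : psdmx A ->
  exists (q : nat) (E : 'M[R]_(n, q)), onbasis E (mxnull A).
Proof. by move=> /mxnull_psd->; apply: onbasis_range_ex. Qed.

Lemma onbasis_fix m n k (F : 'M[R]_(m, n)) (M : 'M[R]_(m, k)) (V : {vspace 'cV[R]_m}) :
  onbasis F V -> (mxrange M <= V)%VS -> F *m F^T *m M = M.
Proof.
move=> [FF <-] /mxrange_subP[Z ->].
by rewrite !mulmxA -(mulmxA F) FF mulmx1.
Qed.

End Ranges.

(** * Solutions of L C = 0, L L^T = S through partial isometries *)

Section Isometry.
Variables (R : realType) (p q : nat) (S : 'M[R]_q) (C : 'M[R]_p).
Hypotheses (Sp : psdmx S) (Cp : psdmx C).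

(** This is [OT_partial_isometry] with S in place of B/A and with C in place of B11^(1/2) G11; for
    the C used later the null spaces agree. *)
Definition range_null_isometry (U : 'M[R]_(p, q)) : Prop :=
  exists V : {vspace 'cV[R]_p},
    [/\ (V <= mxnull C)%VS, \dim V = \dim (mxrange S) &
        partial_isometry U (mxrange S) V].

(** Polar decomposition: U = L^T W with W the pseudoinverse of S^(1/2). As C is symmetric, L C = 0
    gives C U = 0, so V = R(U) lies in N(C). *)
Lemma gram_sqrt_isometry (L : 'M[R]_(q, p)) : L *m C = 0 -> L *m L^T = S ->
  exists2 U, range_null_isometry U & L = mxsqrt S *m U^T.
Proof.
move=> LC LL; have [Zp ZZ] := mxsqrtP Sp; set Z := mxsqrt S in Zp ZZ *.
set W := mpinv Z; have WC : W *m Z = Z *m W by apply: mpinvC.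
have ZWZ : Z *m W *m Z = Z by apply: mulmxVKpinv.
have WE : W = Z *m W *m W by apply: mpinvE.
have WT : W^T = W by apply: tr_mpinv.
have ZWL : Z *m W *m L = L by apply: (mpinv_gramK Zp (Y := Z)); rewrite LL ZZ.
pose U := L^T *m W; have UT : U^T = W *m L by rewrite trmx_mul trmxK WT.
have UU : U^T *m U = Z *m W.
  by rewrite UT mulmxA -(mulmxA W) LL -ZZ mulmxA WC ZWZ.
have UUU : U *m U^T *m U = U.
  by rewrite -mulmxA UU -mulmxA (mulmxA W) WC -WE.
have SWW : Z *m W = S *m (W *m W).
  by rewrite -ZZ !mulmxA -(mulmxA Z Z) -WC mulmxA ZWZ.
have rU : mxrange (U^T *m U) = mxrange S.
  apply/eqP; rewrite eqEsubv; apply/andP; split; apply/mxrange_subP.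
    by exists (W *m W); rewrite UU.
  by exists S; rewrite UU -ZZ mulmxA ZWZ.
have CU : C *m U = 0.
  by rewrite mulmxA -[C]Cp.1 -trmx_mul LC trmx0 mul0mx.
clearbody U; exists U; last by rewrite UT mulmxA.
exists (mxrange U); split.
- by rewrite mxrange_sub_mxnull CU.
- by rewrite dim_mxrange_gram// rU.
- split; last by apply: is_oproj_mxrange; rewrite ?trmx_mul ?trmxK.
  rewrite UU SWW; apply: is_oproj_mxrange; rewrite -SWW.
    by rewrite trmx_mul WT Zp.1.
  by rewrite -ZZ mulmxA ZWZ.
Qed.

Lemma isometry_gram_sqrt U (L := mxsqrt S *m U^T) : range_null_isometry U ->
  L *m C = 0 /\ L *m L^T = S.
Proof.
move=> [V [VC _ [UW UV]]]; have [Zp ZZ] := mxsqrtP Sp.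
have UUZ : U^T *m U *m mxsqrt S = mxsqrt S.
  apply: (is_oproj_fix UW); apply/mxrange_subP; exact: mxsqrt_sub_mxrange.
(* The range of U U^T lies in V, so C U U^T = 0; then (C U)(C U)^T = 0 and C U vanishes. *)
have CU : C *m U = 0.
  have := is_oproj_sub UV => /subv_trans/(_ VC); rewrite mxrange_sub_mxnull.
  move=> /eqP CUU; apply: trmx_inj; rewrite trmx0; apply: gram_eq0.
  by rewrite trmxK trmx_mul mulmxA -(mulmxA C) CUU mul0mx.
rewrite /L; split.
  by rewrite -mulmxA -[C]Cp.1 -trmx_mul CU trmx0 mulmx0.
by rewrite trmx_mul trmxK Zp.1 mulmxA -(mulmxA _ U^T) -mulmxA UUZ ZZ.
Qed.

(** The rank bound leaves room in N(C) for an isometric copy of R(S): [pid_mx] matches the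
    orthonormal basis F1 of R(S) with the first vectors of F2, an orthonormal basis of N(C). *)
Lemma gram_in_null_ex : (\rank S + \rank C <= p)%N ->
  exists L : 'M[R]_(q, p), L *m C = 0 /\ L *m L^T = S.
Proof.
move=> rSC; have [Zp ZZ] := mxsqrtP Sp.
have [F1 oF1] := onbasis_ex S; have [F2 oF2] := onbasis_ex (1%:M - C *m mpinv C).
have rk : (\rank S <= \rank (1%:M - C *m mpinv C)%R)%N.
  rewrite -(leq_add2r (\rank C)) (leq_trans rSC)// -{1}(mxrank1 R p).
  rewrite -{1}[1%:M](subrK (C *m mpinv C)) (leq_trans (mxrank_add _ _))//.
  by rewrite leq_add2l mxrankM_maxl.
have FZ : F1 *m F1^T *m mxsqrt S = mxsqrt S.
  apply: (onbasis_fix oF1); apply/mxrange_subP; exact: mxsqrt_sub_mxrange.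
have CF : C *m F2 = 0.
  by apply/eqP; rewrite -mxrange_sub_mxnull oF2.2 mxnull_psd.
exists (mxsqrt S *m F1 *m pid_mx (\rank S) *m F2^T); split.
  have FC : F2^T *m C = 0 by apply: trmx_inj; rewrite trmx_mul trmxK Cp.1 CF trmx0.
  by rewrite -mulmxA FC mulmx0.
rewrite !trmx_mul trmxK Zp.1 tr_pid_mx !mulmxA -(mulmxA _ F2^T) oF2.1 mulmx1.
rewrite -(mulmxA _ (pid_mx _)) mul_pid_mx minnn (minn_idPr rk) pid_mx_1 mulmx1.
by rewrite -(mulmxA _ F1) -mulmxA FZ ZZ.
Qed.

End Isometry.

(** X x = 0 iff X^T X x = 0. This serves to identify N(B11^(1/2) G11) with N(C), as both Gram
    matrices are G11^T B11 G11. *)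
Lemma mxnull_gram (R : realType) m1 m2 n (X : 'M[R]_(m1, n)) (Y : 'M[R]_(m2, n)) :
  X^T *m X = Y^T *m Y -> mxnull X = mxnull Y.
Proof.
have sub k1 k2 (X1 : 'M[R]_(k1, n)) (Y1 : 'M[R]_(k2, n)) (x : 'cV_n) :
    X1^T *m X1 = Y1^T *m Y1 -> X1 *m x = 0 -> Y1 *m x = 0.
  by move=> XY Xx; apply: mul_gram_eq0; rewrite -XY -mulmxA Xx mulmx0.
move=> XY; apply/vspaceP=> x; rewrite !mem_mxnull.
by apply/eqP/eqP; apply: sub.
Qed.

(** * Schur complements and the completion equations for K *)

(* The blocks of a positive semidefinite matrix are written as the Gram matrices
   of the blocks b1 and b2 of a square root. *)
Section Completion.
Variables (R : realType) (m p q : nat) (b1 : 'M[R]_(m, p)) (b2 : 'M[R]_(m, q)).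
Local Notation B11 := (b1^T *m b1).
(** [P1] is the orthogonal projection onto R(b1), and [Sc] the Schur complement of the Gram matrix
    of (b1 b2). *)
Local Notation P1 := (b1 *m mpinv B11 *m b1^T).
Local Notation Sc := (b2^T *m b2 - b2^T *m b1 *m mpinv B11 *m (b1^T *m b2)).

Lemma tr_gram_proj : P1^T = P1.
Proof. by rewrite !trmx_mul trmxK (tr_mpinv (psdmx_gram b1)) mulmxA. Qed.

Lemma gram_projK : P1 *m b1 = b1.
Proof.
have P1b1 : b1^T *m P1 = b1^T.
  rewrite !mulmxA; apply: (mpinv_gramK (psdmx_gram b1) (Y := 1%:M)).
  by rewrite mulmx1 trmxK.
by move/(congr1 trmx): P1b1; rewrite trmx_mul tr_gram_proj trmxK.
Qed.

Lemma schur_gram : Sc = (b2 - P1 *m b2)^T *m (b2 - P1 *m b2).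
Proof.
have P1P1 : P1 *m P1 = P1 by rewrite [LHS]mulmxA mulmxA gram_projK.
have e (Q : 'M_m) : Q^T = Q -> Q *m Q = Q ->
    (b2 - Q *m b2)^T *m (b2 - Q *m b2) = b2^T *m b2 - b2^T *m Q *m b2.
  move=> QT QQ; have -> : (b2 - Q *m b2)^T = b2^T - b2^T *m Q.
    by rewrite linearB/= trmx_mul QT.
  rewrite mulmxBl !mulmxBr !mulmxA.
  by rewrite -(mulmxA _ Q Q) QQ subrr subr0.
by rewrite e ?tr_gram_proj// !mulmxA.
Qed.

Lemma psdmx_schur_gram : psdmx Sc.
Proof. by rewrite schur_gram; apply: psdmx_gram. Qed.

(** Block elimination: Y corrects X2 by a multiple of X1 so that b Y is orthogonal to b1. The Gram
    matrix of b (X1 Y) is then diag(B11, Sc), and a congruence cannot raise the rank of b^T b. *)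
Lemma rank_schur_gram n (X1 : 'M[R]_(n, p)) (X2 : 'M[R]_(n, q)) (b : 'M[R]_(m, n)) :
  b1 = b *m X1 -> b2 = b *m X2 -> (\rank B11 + \rank Sc <= \rank (b^T *m b))%N.
Proof.
move=> b1E b2E; pose Y := X2 - X1 *m mpinv B11 *m b1^T *m b2.
have bY : b *m Y = b2 - P1 *m b2.
  by rewrite mulmxBr !mulmxA -b1E -b2E.
have orth : b1^T *m (b *m Y) = 0.
  by rewrite bY mulmxBr mulmxA -tr_gram_proj -trmx_mul gram_projK subrr.
rewrite -rank_diag_block_mx -/Sc.
have -> : block_mx B11 0 0 Sc = (row_mx X1 Y)^T *m (b^T *m b) *m row_mx X1 Y.
  have -> : (row_mx X1 Y)^T *m (b^T *m b) *m row_mx X1 Y =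
      (row_mx b1 (b *m Y))^T *m row_mx b1 (b *m Y).
    by rewrite b1E -mul_mx_row trmx_mul !mulmxA.
  rewrite tr_row_mx mul_col_row orth schur_gram -bY; congr block_mx.
  by apply: trmx_inj; rewrite trmx0 trmx_mul trmxK orth.
exact: leq_trans (mxrankM_maxl _ _) (mxrankM_maxr _ _).
Qed.

Variables (G C : 'M[R]_p) (g : 'M[R]_(m, p)).
Hypotheses (Gu : G \in unitmx) (Cp : psdmx C).
Hypotheses (gE : g = b1 *m G) (CC : C *m C = g^T *m g).
(** The particular solution B21 G C^+ of K C = B21 G. *)
Local Notation H := (b2^T *m g *m mpinv C).

Lemma green_pinvK : g *m mpinv C *m C = g.
Proof.
have e : C *m mpinv C *m g^T = g^T.
  by apply: (mpinv_gramK Cp (Y := C)); rewrite trmxK.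
by move/(congr1 trmx): e; rewrite trmxK (trmx_mul _ g^T) trmxK (trmx_mul C)
  (tr_mpinv Cp) Cp.1 mulmxA.
Qed.

(* Both sides are the orthogonal projection onto R(b1). *)
Lemma green_projE : g *m mpinv C *m mpinv C *m g^T = P1.
Proof.
set Q := LHS; have QT : Q^T = Q by rewrite /Q !trmx_mul (tr_mpinv Cp) trmxK !mulmxA.
have Qb1 : Q *m b1 = b1.
  suff Qg : Q *m g = g by rewrite -(mulmxK Gu b1) -gE mulmxA Qg.
  rewrite /Q -mulmxA -CC mulmxA -(mulmxA _ (mpinv C) C) (mpinvC Cp) mulmxA.
  by rewrite !green_pinvK.
have P1Q : P1 *m Q = Q by rewrite /Q gE !mulmxA gram_projK.
(* Transposing P1 Q = Q gives Q = Q P1, and Q P1 = P1 because Q fixes b1. *)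
by rewrite -QT -P1Q trmx_mul QT tr_gram_proj mulmxA mulmxA Qb1.
Qed.

Lemma completion_gramE : H *m H^T + Sc = b2^T *m b2.
Proof.
have -> : H *m H^T = b2^T *m (g *m mpinv C *m mpinv C *m g^T) *m b2.
  by rewrite !trmx_mul (tr_mpinv Cp) trmxK !mulmxA.
by rewrite green_projE !mulmxA addrC subrK.
Qed.

(** For L = K - H, L C = 0 forces L H^T = 0 because C^+ = C C^+ C^+. The cross terms of K K^T
    therefore vanish, and H H^T accounts for all of B22 except the Schur complement. *)
Lemma completionP (K : 'M[R]_(q, p)) :
  K *m C = b2^T *m g /\ K *m K^T = b2^T *m b2 <->
  (K - H) *m C = 0 /\ (K - H) *m (K - H)^T = Sc.
Proof.
have HC : H *m C = b2^T *m g by rewrite -!mulmxA (mulmxA g) green_pinvK.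
set L := K - H; have -> : K = H + L by rewrite addrC subrK.
rewrite mulmxDl HC.
have LCE : (b2^T *m g + L *m C = b2^T *m g) <-> (L *m C = 0).
  by split=> [/eqP|->]; rewrite ?addr0// addrC -subr_eq0 addrK => /eqP.
have LH : L *m C = 0 -> L *m H^T = 0.
  move=> LC; rewrite trmx_mul (tr_mpinv Cp) (mpinvE Cp) !mulmxA LC.
  by rewrite !mul0mx.
have LLE : L *m C = 0 -> (H + L) *m (H + L)^T = H *m H^T + L *m L^T.
  move=> /LH LH0; have -> : (H + L)^T = H^T + L^T by rewrite linearD.
  rewrite mulmxDl !mulmxDr LH0 add0r.
  have -> : H *m L^T = 0.
    by apply: trmx_inj; rewrite trmx0 (trmx_mul H) trmxK.
  by rewrite addr0.
split=> [[/LCE LC]|[LC LL]]; last by split; [apply/LCE|rewrite LLE// LL completion_gramE].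
by rewrite LLE// => e; split=> //; apply: (addrI (H *m H^T)); rewrite e completion_gramE.
Qed.

End Completion.

(** * Block form of OT matrices in the singular case *)

Section Blocks.
Variables (R : realType) (n p q : nat) (A B : 'M[R]_n).
Variables (E1 : 'M[R]_(n, p)) (E2 : 'M[R]_(n, q)).
Hypotheses (Ap : psdmx A) (Bp : psdmx B).
Hypotheses (oE1 : onbasis E1 (mxrange A)) (oE2 : onbasis E2 (mxnull A)).
Local Notation E := (row_mx E1 E2).

Lemma range_null_orth : E2^T *m E1 = 0.
Proof.
have /mxrange_subP[Z ->] : (mxrange E1 <= mxrange A)%VS by rewrite oE1.2.
have /eqP AE2 : A *m E2 == 0 by rewrite -mxrange_sub_mxnull oE2.2.
by rewrite mulmxA -{1}Ap.1 -trmx_mul AE2 trmx0 mul0mx.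
Qed.

Lemma range_null_gram : E^T *m E = 1%:M.
Proof.
have E12 : E1^T *m E2 = 0.
  by apply: trmx_inj; rewrite trmx_mul trmxK range_null_orth trmx0.
by rewrite tr_row_mx mul_col_row range_null_orth E12 oE1.1 oE2.1 -scalar_mx_block.
Qed.

(** With P = E1 E1^T, A P = A puts the range of 1 - P in N(A). So E2 E2^T fixes 1 - P, and it kills
    P by orthogonality, whence it equals 1 - P. *)
Lemma range_null_resolution : E *m E^T = 1%:M.
Proof.
rewrite tr_row_mx mul_row_col; set P := E1 *m E1^T.
have PA : P *m A = A by apply: (onbasis_fix oE1).
have PT : P^T = P by rewrite trmx_mul trmxK.
have AP : A *m P = A by rewrite -{1}Ap.1 -PT -trmx_mul PA Ap.1.
have QP : E2 *m E2^T *m (1%:M - P) = 1%:M - P.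
  by apply: (onbasis_fix oE2); rewrite mxrange_sub_mxnull mulmxBr mulmx1 AP subrr.
have E2P : E2 *m E2^T *m P = 0.
  by rewrite -mulmxA (mulmxA E2^T) range_null_orth mul0mx mulmx0.
by move: QP; rewrite mulmxBr mulmx1 E2P subr0 => ->; rewrite addrC subrK.
Qed.

Lemma mxrank_range_basis : \rank A = p.
Proof.
have /mxrange_subP[Z AE] : (mxrange A <= mxrange E1)%VS by rewrite oE1.2.
have /mxrange_subP[Y E1E] : (mxrange E1 <= mxrange A)%VS by rewrite oE1.2.
apply/eqP; rewrite eqn_leq {1}AE (leq_trans (mxrankM_maxl _ _)) ?rank_leq_col//=.
by rewrite -{1}(mxrank1 R p) -oE1.1 {2}E1E mulmxA (leq_trans (mxrankM_maxl _ _)) ?mxrankM_maxr.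
Qed.

Lemma range_blkE : E1 *m blk E1 E1 A *m E1^T = A.
Proof.
have PA : E1 *m E1^T *m A = A by apply: (onbasis_fix oE1).
rewrite /blk !mulmxA PA -mulmxA; apply: trmx_inj.
by rewrite !trmx_mul trmxK Ap.1 PA.
Qed.

Lemma of_blocksE (T : 'M[R]_n) :
  T = of_blocks E1 E2 (blk E1 E1 T) (blk E1 E2 T) (blk E2 E1 T) (blk E2 E2 T).
Proof.
rewrite /of_blocks /blk.
have -> : block_mx (E1^T *m T *m E1) (E1^T *m T *m E2) (E2^T *m T *m E1)
    (E2^T *m T *m E2) = E^T *m T *m E by rewrite tr_row_mx mul_col_mx mul_col_row.
by rewrite !mulmxA range_null_resolution mul1mx -mulmxA range_null_resolution mulmx1.
Qed.

Lemma blk_of_blocks (X11 : 'M[R]_p) X12 X21 (X22 : 'M[R]_q)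
    (T := of_blocks E1 E2 X11 X12 X21 X22) :
  [/\ blk E1 E1 T = X11, blk E1 E2 T = X12, blk E2 E1 T = X21 & blk E2 E2 T = X22].
Proof.
apply: eq_block_mx; rewrite /blk.
have -> : block_mx (E1^T *m T *m E1) (E1^T *m T *m E2) (E2^T *m T *m E1)
    (E2^T *m T *m E2) = E^T *m T *m E by rewrite tr_row_mx mul_col_mx mul_col_row.
rewrite /T /of_blocks !mulmxA range_null_gram mul1mx.
by rewrite -mulmxA range_null_gram mulmx1.
Qed.

Lemma blk_inj (X Y : 'M[R]_n) : blk E1 E1 X = blk E1 E1 Y ->
  blk E1 E2 X = blk E1 E2 Y -> blk E2 E1 X = blk E2 E1 Y ->
  blk E2 E2 X = blk E2 E2 Y -> X = Y.
Proof. by move=> e1 e2 e3 e4; rewrite (of_blocksE X) e1 e2 e3 e4 -of_blocksE. Qed.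

Lemma tr_blk r s (F1 : 'M[R]_(n, r)) (F2 : 'M[R]_(n, s)) (X : 'M[R]_n) :
  (blk F1 F2 X)^T = blk F2 F1 X^T.
Proof. by rewrite /blk !trmx_mul trmxK mulmxA. Qed.

Lemma tr_of_blocks (X11 : 'M[R]_p) X12 X21 (X22 : 'M[R]_q) :
  (of_blocks E1 E2 X11 X12 X21 X22)^T = of_blocks E1 E2 X11^T X21^T X12^T X22^T.
Proof. by rewrite /of_blocks !trmx_mul trmxK tr_block_mx mulmxA. Qed.

(** This supplies the b1 and b2 of the completion equations, namely B^(1/2) E1 and B^(1/2) E2. *)
Lemma blk_gram r s (F1 : 'M[R]_(n, r)) (F2 : 'M[R]_(n, s)) :
  blk F1 F2 B = (mxsqrt B *m F1)^T *m (mxsqrt B *m F2).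
Proof.
have [bp bb] := mxsqrtP Bp.
by rewrite trmx_mul bp.1 /blk -{1}bb !mulmxA.
Qed.

Section Green.
Variable G : 'M[R]_p.
Hypothesis GA : green (blk E1 E1 A) G.
Local Notation C := (mxsqrt (G^T *m blk E1 E1 B *m G)).

(** A = E1 A11 E1^T has rank p, so the p x p block A11 has full rank. *)
Lemma green_unit : G \in unitmx.
Proof.
suff : blk E1 E1 A \in unitmx by rewrite -GA unitmx_mul => /andP[].
rewrite -row_free_unit /row_free eqn_leq rank_leq_col -{1}mxrank_range_basis.
by rewrite -{1}range_blkE (leq_trans (mxrankM_maxl _ _)) ?mxrankM_maxr.
Qed.

Lemma green_range : (E1 *m G) *m (E1 *m G)^T = A.
Proof. by rewrite trmx_mul mulmxA -(mulmxA E1) GA range_blkE. Qed.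

Lemma psdmx_blk : psdmx (blk E1 E1 B).
Proof. by rewrite blk_gram; apply: psdmx_gram. Qed.

(** With the factor E1 G of A, only the first block column of T enters. In T A T^T = B the 11 block
    follows from the formula for T11 and the 12 block from the 21 block by symmetry; the 21 and 22
    blocks are the equations for T21. *)
Lemma is_OT_blk T : is_OT A B T <->
  [/\ blk E1 E1 T = OT_map G (blk E1 E1 B),
      (blk E2 E1 T *m G) *m C = blk E2 E1 B *m G &
      (blk E2 E1 T *m G) *m (blk E2 E1 T *m G)^T = blk E2 E2 B].
Proof.
have Gu := green_unit.
have [Cp CC] := mxsqrtP (psdmx_congr G psdmx_blk).
rewrite (is_OTE T Ap Bp green_range).
have blkE X : (E1 *m G)^T *m X *m (E1 *m G) = G^T *m blk E1 E1 X *m G.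
  by rewrite trmx_mul /blk !mulmxA.
rewrite !blkE.
have blkTAT r s (F1 : 'M[R]_(n, r)) (F2 : 'M[R]_(n, s)) :
    blk F1 F2 (T *m A *m T^T) = (blk F1 E1 T *m G) *m (blk F2 E1 T *m G)^T.
  by rewrite -green_range /blk !trmx_mul trmxK !mulmxA.
have T11E : blk E1 E1 T = OT_map G (blk E1 E1 B) -> (blk E1 E1 T *m G)^T = C *m invmx G.
  move=> ->; rewrite /OT_map mulmxKV// trmx_mul -trmx_inv trmxK.
  by rewrite Cp.1.
split=> [[TAT /(OT_map_unique Gu) T11]|[T11 T21 T22]]; split=> //.
- have := congr1 (blk E2 E1) TAT; rewrite blkTAT T11E// mulmxA => <-.
  by rewrite mulmxKV.
- by rewrite -blkTAT TAT.
- have e21 : blk E2 E1 (T *m A *m T^T) = blk E2 E1 B.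
    by rewrite blkTAT T11E// mulmxA T21 mulmxK.
  apply: blk_inj => //; last by rewrite blkTAT.
    rewrite blkTAT T11E// T11 mulmxA /OT_map mulmxKV// -(mulmxA _ C C) CC.
    by rewrite !mulmxA mulVmx ?unitmx_tr// mul1mx mulmxK.
  apply: trmx_inj; rewrite !tr_blk Bp.1 -e21; congr blk.
  by rewrite !trmx_mul trmxK Ap.1 mulmxA.
- by rewrite T11 (OT_mapP psdmx_blk Gu).2.
Qed.

Lemma OT_partial_isometryE U :
  OT_partial_isometry E1 E2 B G U <-> range_null_isometry (schur E1 E2 B) C U.
Proof.
rewrite /OT_partial_isometry /range_null_isometry.
suff -> : mxnull (mxsqrt (blk E1 E1 B) *m G) = mxnull C by [].
have [Cp CC] := mxsqrtP (psdmx_congr G psdmx_blk).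
have [[ST _] SS] := mxsqrtP psdmx_blk.
by apply: mxnull_gram; rewrite Cp.1 CC trmx_mul ST !mulmxA -(mulmxA _ (mxsqrt _) (mxsqrt _)) SS /blk !mulmxA.
Qed.

Lemma psdmx_schur : psdmx (schur E1 E2 B).
Proof. by rewrite /schur !blk_gram; apply: psdmx_schur_gram. Qed.

(** K = T21 G solves the completion equations, and L = K - K0 corresponds to a partial isometry by
    [gram_sqrt_isometry] and [isometry_gram_sqrt]. T12 and T22 are free because [is_OT_blk] does not
    constrain them. *)
Lemma OT_familyP T : is_OT A B T <-> OT_family E1 E2 B G T.
Proof.
have Gu := green_unit; have [Cp CC] := mxsqrtP (psdmx_congr G psdmx_blk).
have CCg : C *m C = (mxsqrt B *m E1 *m G)^T *m (mxsqrt B *m E1 *m G).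
  by rewrite CC blk_gram (trmx_mul _ G) !mulmxA.
have cP := completionP (mxsqrt B *m E2) Gu Cp erefl CCg.
have scE : schur E1 E2 B = (mxsqrt B *m E2)^T *m (mxsqrt B *m E2) -
    (mxsqrt B *m E2)^T *m (mxsqrt B *m E1) *m
    mpinv ((mxsqrt B *m E1)^T *m (mxsqrt B *m E1)) *m
    ((mxsqrt B *m E1)^T *m (mxsqrt B *m E2)) by rewrite /schur !blk_gram.
rewrite is_OT_blk !(blk_gram E2).
have HE : (mxsqrt B *m E2)^T *m (mxsqrt B *m E1) *m G =
   (mxsqrt B *m E2)^T *m (mxsqrt B *m E1 *m G) by rewrite !mulmxA.
split=> [[T11 T21 T22]|[U [T12 [T22 [UP ->]]]]].
  have [] := (cP (blk E2 E1 T *m G)).1; first by rewrite -HE.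
  rewrite -scE => LC LL.
  have [U UP UE] := gram_sqrt_isometry psdmx_schur Cp LC LL.
  exists U, (blk E1 E2 T), (blk E2 E2 T); split; first exact/OT_partial_isometryE.
  rewrite /OT_matrix /OT_block21 -UE (blk_gram E2 E1) HE addrC subrK mulmxK//.
  by rewrite -T11 -of_blocksE.
have [-> _ -> _] := blk_of_blocks (OT_map G (blk E1 E1 B)) T12 (OT_block21 E1 E2 B G U) T22.
have [LC LL] := isometry_gram_sqrt psdmx_schur Cp ((OT_partial_isometryE U).1 UP).
have [] := (cP (OT_block21 E1 E2 B G U *m G)).2.
  rewrite -scE /OT_block21 mulmxKV// (blk_gram E2 E1) HE.
  by rewrite [_ + mxsqrt _ *m _]addrC addrK.
by rewrite HE; split.
Qed.

Lemma OT_partial_isometry_ex : (\rank B <= \rank A)%N ->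
  exists U, OT_partial_isometry E1 E2 B G U.
Proof.
move=> rBA; have [Cp CC] := mxsqrtP (psdmx_congr G psdmx_blk).
(* C = C^+ C^2 = C^+ G^T B11 G. *)
have rC : (\rank C <= \rank (blk E1 E1 B))%N.
  rewrite -(mulmxVKpinv Cp) -(mpinvC Cp) -mulmxA CC.
  rewrite (leq_trans (mxrankM_maxr _ _))// (leq_trans (mxrankM_maxl _ _))//.
  exact: mxrankM_maxr.
have rk : (\rank (schur E1 E2 B) + \rank C <= p)%N.
  rewrite -[leqRHS]mxrank_range_basis (leq_trans _ rBA)// addnC.
  rewrite (leq_trans (leq_add rC (leqnn _)))//.
  have [[bT _] bb] := mxsqrtP Bp.
  have := rank_schur_gram (X1 := E1) (X2 := E2) (b := mxsqrt B) erefl erefl.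
  by rewrite bT bb /schur !blk_gram.
have [L [LC LL]] := gram_in_null_ex psdmx_schur Cp rk.
(* Any solution L yields the required isometry as its polar factor. *)
have [U UP _] := gram_sqrt_isometry psdmx_schur Cp LC LL.
by exists U; apply/OT_partial_isometryE.
Qed.

Lemma OT_matrix_sym U (T22 : 'M[R]_q) : OT_partial_isometry E1 E2 B G U -> T22^T = T22 ->
  let T := OT_matrix E1 E2 B G U (OT_block21 E1 E2 B G U)^T T22 in
  is_OT A B T /\ T^T = T.
Proof.
move=> UP T22T T; split; first by apply/OT_familyP; exists U, (OT_block21 E1 E2 B G U)^T, T22.
by rewrite /T /OT_matrix tr_of_blocks trmxK T22T (OT_mapP psdmx_blk green_unit).1.1.
Qed.

End Green.

Lemma green_blk_ex : exists G, green (blk E1 E1 A) G.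
Proof.
have A11 : psdmx (blk E1 E1 A) by apply: psdmx_congr.
by have [[ST _] SS] := mxsqrtP A11; exists (mxsqrt (blk E1 E1 A)); rewrite /green ST.
Qed.

End Blocks.

(** * The rank criterion and assembly of both cases *)

Lemma is_OT_rank (R : realType) n (A B T : 'M[R]_n) : is_OT A B T -> (\rank B <= \rank A)%N.
Proof. by case=> <- _; apply: leq_trans (mxrankM_maxl _ _) (mxrankM_maxr _ _). Qed.

Lemma symmetric_OT_ex (R : realType) n (A B : 'M[R]_n) : psdmx A -> psdmx B ->
  (\rank B <= \rank A)%N -> exists T, is_OT A B T /\ T^T = T.
Proof.
move=> Ap Bp rBA; have [p [E1 oE1]] := onbasis_range_ex A.
have [q [E2 oE2]] := onbasis_null_ex Ap; have [G GA] := green_blk_ex E1 Ap.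
have [U UP] := OT_partial_isometry_ex E2 Bp oE1 G rBA.
(* [trmx0] selects T22 = 0. *)
by eexists; apply: (OT_matrix_sym Ap Bp oE1 oE2 GA UP (trmx0 _ _ _)).
Qed.

Theorem theorem3p1 (R : realType) (n : nat) (A B : 'M[R]_n)
    (hA : psdmx A) (hB : psdmx B) :
  (pdmx A ->
     [/\ OT_exists A B,
         (exists! T : 'M[R]_n, is_OT A B T),
         (forall G : 'M[R]_n, green A G ->
           [/\ G \in unitmx, psdmx (OT_map G B) &
               forall T : 'M[R]_n, is_OT A B T <-> T = OT_map G B]) &
         forall G G' : 'M[R]_n, green A G -> green A G' ->
           OT_map G B = OT_map G' B])
  /\
  ((\rank A < n)%N ->
     (OT_exists A B <-> (\rank B <= \rank A)%N) /\
     (OT_exists A B ->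
        (forall (p q : nat) (E1 : 'M[R]_(n, p)) (E2 : 'M[R]_(n, q)),
           onbasis E1 (mxrange A) -> onbasis E2 (mxnull A) ->
           [/\ (forall G11 : 'M[R]_p, green (blk E1 E1 A) G11 ->
                 G11 \in unitmx /\
                 forall T : 'M[R]_n,
                   is_OT A B T <-> OT_family E1 E2 B G11 T),
               (forall G11 G11' : 'M[R]_p,
                 green (blk E1 E1 A) G11 -> green (blk E1 E1 A) G11' ->
                 OT_family E1 E2 B G11 = OT_family E1 E2 B G11') &
               forall (G11 : 'M[R]_p) (U12 : 'M[R]_(p, q)) (T22 : 'M[R]_q),
                 green (blk E1 E1 A) G11 ->
                 OT_partial_isometry E1 E2 B G11 U12 ->
                 T22^T = T22 ->
                 let T := OT_matrix E1 E2 B G11 U12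
                            (OT_block21 E1 E2 B G11 U12)^T T22 in
                 is_OT A B T /\ T^T = T])
        /\ (exists T : 'M[R]_n, is_OT A B T /\ T^T = T))).
Proof.
split=> [Apd|_].
  have unit_green G : green A G -> G \in unitmx.
    by move=> GA; have := pdmx_unit Apd; rewrite -GA unitmx_mul => /andP[].
  have OTP G T (GA : green A G) := is_OT_pd T hA hB (unit_green _ GA) GA.
  have [[ST _] SS] := mxsqrtP hA.
  have SA : green A (mxsqrt A) by rewrite /green ST.
  have S_OT := (OTP _ _ SA).2 erefl.
  split.
  - by exists (OT_map (mxsqrt A) B).
  - by exists (OT_map (mxsqrt A) B); split=> // T /(OTP _ _ SA).
  - move=> G GA; have Gu := unit_green _ GA.
    by split=> // [|T]; [case: (OT_mapP hB Gu)|apply: OTP].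
  (* The matrix built from G is an OT matrix, so the characterization through G' identifies the
     two. *)
  - by move=> G G' GA GA'; apply/(OTP _ _ GA')/(OTP _ _ GA).
have OT_rank : OT_exists A B <-> (\rank B <= \rank A)%N.
  split=> [[T /is_OT_rank//]|/(symmetric_OT_ex hA hB)[T [TP _]]]; by exists T.
split=> // /OT_rank rBA; split; last exact: symmetric_OT_ex.
move=> p q E1 E2 oE1 oE2; split.
- move=> G GA; split=> [|T]; first exact: (green_unit hA oE1 GA).
  exact: (OT_familyP hA hB oE1 oE2 GA).
(* Each family is the set of all OT matrices, whose definition does not involve the chosen G11. *)
- move=> G G' GA GA'; apply/predeqP => T.
  by rewrite -(OT_familyP hA hB oE1 oE2 GA) -(OT_familyP hA hB oE1 oE2 GA').
- by move=> G U T22 GA; apply: (OT_matrix_sym hA hB oE1 oE2 GA).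
Qed.
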